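(* Let $\mathcal{C}$ be a Calabi-Yau triangulated category of CY-dimension 2 (with the standing assumptions listed in the context) which has a cluster-tilting object $T$, and let $\Gamma=\operatorname{End}_{\mathcal{C}}(T)$ be the endomorphism algebra of $T$. Let $L$ be a tilting module over $\Gamma$. Then $L$ lifts to a cluster-tilting object in $\mathcal{C}$; that is, there exists a cluster-tilting object $L^+$ of $\mathcal{C}$ such that $\operatorname{Hom}_{\mathcal{C}}(T,L^+)\simeq L$ as right $\Gamma$-modules.
   Context: Setting: $k$ is an algebraically closed field. $\mathcal{C}$ is a Krull-Schmidt triangulated $k$-linear category with split idempotents and suspension functor $S$, all of whose $\operatorname{Hom}$-spaces are finite-dimensional over $k$, and which admits a Serre functor $\Sigma$. $\mathcal{C}$ is Calabi-Yau of CY-dimension 2 (2-Calabi-Yau) if there is an isomorphism of triangle functors $S^2\simeq\Sigma$. For $X,Y\in\mathcal{C}$ and $n\in\mathbb{Z}$, $\operatorname{Ext}^n_{\mathcal{C}}(X,Y)=\operatorname{Hom}_{\mathcal{C}}(X,S^nY)$. The 2-Calabi-Yau property gives bifunctorial isomorphisms $D\operatorname{Ext}^1_{\mathcal{C}}(X,Y)\simeq\operatorname{Ext}^1_{\mathcal{C}}(Y,X)$, where $D=\operatorname{Hom}_k(-,k)$. For an object $T$ of $\mathcal{C}$, $\operatorname{add}T$ is the full subcategory formed by the direct factors of finite direct sums of copies of $T$. An object $T$ of $\mathcal{C}$ is cluster-tilting if (i) $\operatorname{Ext}^1_{\mathcal{C}}(T,T)=0$, and (ii) for any $X\in\mathcal{C}$,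 if $\operatorname{Hom}_{\mathcal{C}}(X,ST)=0$ then $X$ belongs to $\operatorname{add}T$. For a finite-dimensional $k$-algebra $A$, $\operatorname{mod}A$ is the category of finite-dimensional right $A$-modules. A module $L\in\operatorname{mod}A$ is a tilting module if $\operatorname{pd}_A L\le 1$, $\operatorname{Ext}^1_A(L,L)=0$, and there is an exact sequence $0\to A\to L^0\to L^1\to 0$ with $L^0,L^1\in\operatorname{add}L$ (direct summands of finite direct sums of copies of $L$). The functor $F=\operatorname{Hom}_{\mathcal{C}}(T,-):\mathcal{C}\to\operatorname{mod}\Gamma$ induces an equivalence $\mathcal{C}/\operatorname{add}ST\simeq\operatorname{mod}\Gamma$, where $\mathcal{C}/\operatorname{add}ST$ is the quotient of $\mathcal{C}$ by the ideal of morphisms factoring through objects of $\operatorname{add}ST$ (Keller-Reiten). *)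

(* Defs.v *)
From HB Require Import structures.
From mathcomp Require Import all_boot all_order all_algebra.

Set Implicit Arguments.
Unset Strict Implicit.
Unset Printing Implicit Defensive.

Import GRing.Theory.
Local Open Scope ring_scope.

Declare Scope lincat_scope.
Local Open Scope lincat_scope.

Reserved Notation "g \oc f" (at level 40, left associativity).

(* Hom-finite k-linear categories: [vectType k] is the type of
   finite-dimensional k-vector spaces. *)
Record lincat (k : fieldType) := LinCat {
  obj :> Type;
  hom : obj -> obj -> vectType k;
  idm : forall X : obj, hom X X;
  comp : forall X Y Z : obj, hom Y Z -> hom X Y -> hom X Z;
  compA : forall (X Y Z W : obj) (h : hom Z W) (g : hom Y Z) (f : hom X Y),
    comp h (comp g f) = comp (comp h g) f;
  comp1m : forall (X Y : obj) (f : hom X Y), comp (idm Y) f = f;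
  compm1 : forall (X Y : obj) (f : hom X Y), comp f (idm X) = f;
  comp_linearl : forall (X Y Z : obj) (f : hom X Y),
    linear (fun g : hom Y Z => comp g f);
  comp_linearr : forall (X Y Z : obj) (g : hom Y Z),
    linear (fun f : hom X Y => comp g f)
}.
Arguments hom {k l} X Y.
Arguments idm {k l} X.
Arguments comp {k l X Y Z} g f.
Notation "g \oc f" := (comp g f) : lincat_scope.

Definition is_iso (k : fieldType) (C : lincat k) (X Y : C) (f : hom X Y) : Prop :=
  exists g : hom Y X, g \oc f = idm X /\ f \oc g = idm Y.

Definition is_zero_obj (k : fieldType) (C : lincat k) (X : C) : Prop :=
  idm X = 0.

Definition is_direct_sum (k : fieldType) (C : lincat k) (I : finType)
    (F : I -> C) (Y : C) : Prop :=
  exists (inj : forall i, hom (F i) Y) (prj : forall i, hom Y (F i)),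
    [/\ forall i, prj i \oc inj i = idm (F i),
        forall i j, i != j -> prj j \oc inj i = 0
      & \sum_i (inj i \oc prj i) = idm Y].

(* The empty family (n = 0) gives a zero object. *)
Definition additive_cat (k : fieldType) (C : lincat k) : Prop :=
  forall (n : nat) (F : 'I_n -> C), exists Y : C, is_direct_sum F Y.

Definition direct_factor (k : fieldType) (C : lincat k) (X Y : C) : Prop :=
  exists X' : C, is_direct_sum (fun b : bool => if b then X else X') Y.

Definition in_add (k : fieldType) (C : lincat k) (T X : C) : Prop :=
  exists (n : nat) (Y : C),
    is_direct_sum (fun _ : 'I_n => T) Y /\ direct_factor X Y.

Definition split_idempotents (k : fieldType) (C : lincat k) : Prop :=
  forall (X : C) (e : hom X X), e \oc e = e ->
    exists (Y : C) (r : hom X Y) (s : hom Y X),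
      r \oc s = idm Y /\ s \oc r = e.

(* The endomorphism ring of X is local: it is nonzero and its non-units are
   closed under addition. *)
Definition local_end (k : fieldType) (C : lincat k) (X : C) : Prop :=
  idm X <> 0 /\
  forall f g : hom X X, is_iso (f + g) -> is_iso f \/ is_iso g.

Definition krull_schmidt (k : fieldType) (C : lincat k) : Prop :=
  forall X : C, exists (n : nat) (F : 'I_n -> C),
    (forall i, local_end (F i)) /\ is_direct_sum F X.

Record linfunctor (k : fieldType) (C D : lincat k) := LinFunctor {
  fobj :> C -> D;
  fmap : forall X Y : C, hom X Y -> hom (fobj X) (fobj Y);
  fmap_linear : forall X Y : C, linear (@fmap X Y);
  fmap1 : forall X : C, fmap (idm X) = idm (fobj X);
  fmap_comp : forall (X Y Z : C) (g : hom Y Z) (f : hom X Y),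
    fmap (g \oc f) = fmap g \oc fmap f
}.
Arguments fmap {k C D} l {X Y} f.

Lemma idfun_linear (k : fieldType) (V : vectType k) : linear (fun v : V => v).
Proof. by []. Qed.

Definition functor_id (k : fieldType) (C : lincat k) : linfunctor C C :=
  @LinFunctor k C C (fun X => X) (fun X Y f => f)
    (fun X Y => @idfun_linear k (hom X Y)) (fun X => erefl)
    (fun X Y Z g f => erefl).

Section FunctorComp.
Context (k : fieldType) (C D E : lincat k).
Context (G : linfunctor D E) (F : linfunctor C D).

Lemma functor_comp_linear X Y :
  linear (fun f : hom X Y => fmap G (fmap F f)).
Proof. by move=> a f g; rewrite !fmap_linear. Qed.

Lemma functor_comp1 X : fmap G (fmap F (idm X)) = idm (G (F X)).
Proof. by rewrite !fmap1. Qed.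

Lemma functor_comp_comp X Y Z (g : hom Y Z) (f : hom X Y) :
  fmap G (fmap F (g \oc f)) = fmap G (fmap F g) \oc fmap G (fmap F f).
Proof. by rewrite !fmap_comp. Qed.

Definition functor_comp : linfunctor C E :=
  @LinFunctor k C E (fun X => G (F X)) (fun X Y f => fmap G (fmap F f))
    functor_comp_linear functor_comp1 functor_comp_comp.
End FunctorComp.

Definition is_natural_iso (k : fieldType) (C D : lincat k)
    (F G : linfunctor C D) (eta : forall X : C, hom (F X) (G X)) : Prop :=
  (forall (X Y : C) (f : hom X Y), eta Y \oc fmap F f = fmap G f \oc eta X) /\
  (forall X : C, is_iso (eta X)).

Definition is_equivalence (k : fieldType) (C D : lincat k)
    (F : linfunctor C D) : Prop :=
  exists G : linfunctor D C,
    (exists eta, @is_natural_iso k C C (functor_comp G F) (functor_id C) eta) /\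
    (exists eps, @is_natural_iso k D D (functor_comp F G) (functor_id D) eps).

(* [dist u v w] says that X -u-> Y -v-> Z -w-> S X is a distinguished
   triangle; S is only required to be an autoequivalence. *)
Record tricat (k : fieldType) := TriCat {
  tri_lincat :> lincat k;
  tri_additive : additive_cat tri_lincat;
  susp : linfunctor tri_lincat tri_lincat;
  susp_equiv : is_equivalence susp;
  dist : forall X Y Z : tri_lincat,
    hom X Y -> hom Y Z -> hom Z (susp X) -> Prop;
  (* TR1 *)
  dist_iso : forall (X Y Z X' Y' Z' : tri_lincat)
      (u : hom X Y) (v : hom Y Z) (w : hom Z (susp X))
      (u' : hom X' Y') (v' : hom Y' Z') (w' : hom Z' (susp X'))
      (a : hom X X') (b : hom Y Y') (c : hom Z Z'),
    is_iso a -> is_iso b -> is_iso c ->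
    b \oc u = u' \oc a -> c \oc v = v' \oc b -> fmap susp a \oc w = w' \oc c ->
    dist u v w -> dist u' v' w';
  dist_idm : forall X Z : tri_lincat, is_zero_obj Z ->
    dist (idm X) (0 : hom X Z) (0 : hom Z (susp X));
  dist_cone : forall (X Y : tri_lincat) (u : hom X Y),
    exists (Z : tri_lincat) (v : hom Y Z) (w : hom Z (susp X)), dist u v w;
  (* TR2 *)
  dist_rot : forall (X Y Z : tri_lincat)
      (u : hom X Y) (v : hom Y Z) (w : hom Z (susp X)),
    dist u v w <-> dist v w (- fmap susp u);
  (* TR3 *)
  dist_morph : forall (X Y Z X' Y' Z' : tri_lincat)
      (u : hom X Y) (v : hom Y Z) (w : hom Z (susp X))
      (u' : hom X' Y') (v' : hom Y' Z') (w' : hom Z' (susp X'))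
      (a : hom X X') (b : hom Y Y'),
    dist u v w -> dist u' v' w' -> b \oc u = u' \oc a ->
    exists c : hom Z Z', c \oc v = v' \oc b /\ fmap susp a \oc w = w' \oc c;
  (* TR4: cones Z' of f, X' of g, Y' of g \oc f *)
  dist_octahedral : forall (X Y Z X' Y' Z' : tri_lincat)
      (f : hom X Y) (g : hom Y Z)
      (i : hom Y Z') (i' : hom Z' (susp X))
      (j : hom Z X') (j' : hom X' (susp Y))
      (l : hom Z Y') (l' : hom Y' (susp X)),
    dist f i i' -> dist g j j' -> dist (g \oc f) l l' ->
    exists (p : hom Z' Y') (q : hom Y' X'),
      [/\ dist p q (fmap susp i \oc j'),
          l \oc g = p \oc i,
          i' = l' \oc p,
          j = q \oc l
        & fmap susp f \oc l' = j' \oc q]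
}.
Arguments susp {k} t.
Arguments dist {k t X Y Z} u v w.

(* (F, eta), with eta : F S -> S F, is a triangle functor. *)
Definition is_triangle_functor (k : fieldType) (C D : tricat k)
    (F : linfunctor C D)
    (eta : forall X : C, hom (F (susp C X)) (susp D (F X))) : Prop :=
  @is_natural_iso k C D (functor_comp F (susp C)) (functor_comp (susp D) F) eta
  /\ forall (X Y Z : C) (u : hom X Y) (v : hom Y Z) (w : hom Z (susp C X)),
       dist u v w -> dist (fmap F u) (fmap F v) (eta X \oc fmap F w).

Definition is_triangle_iso (k : fieldType) (C D : tricat k)
    (F G : linfunctor C D)
    (etaF : forall X : C, hom (F (susp C X)) (susp D (F X)))
    (etaG : forall X : C, hom (G (susp C X)) (susp D (G X)))
    (theta : forall X : C, hom (F X) (G X)) : Prop :=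
  is_natural_iso theta /\
  forall X : C, etaG X \oc theta (susp C X) = fmap (susp D) (theta X) \oc etaF X.

(* A Serre functor, with its duality Hom(Y, Sigma X) ~ D Hom(X, Y) natural in
   X and Y, and with its canonical triangle functor structure eta
   (Bondal-Kapranov, Van den Bergh).  The latter is characterised by
   Tr_(S X) (eta_X^-1 \oc S f) = - Tr_X f for f : X -> Sigma X, where
   Tr_X f = serre_dual f (idm X); [serre_etaE] is the equivalent form for the
   pairing Hom(Y, Sigma X) x Hom(X, Y) -> k.  With this sign, an n-Calabi-Yau
   category is one with (Sigma, eta) isomorphic to (S^n, (-1)^n). *)
Record serre_functor (k : fieldType) (C : tricat k) := SerreFunctor {
  serre :> linfunctor C C;
  serre_equiv : is_equivalence serre;
  serre_dual : forall X Y : C, hom Y (serre X) -> 'Hom(hom X Y, k^o);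
  serre_dual_linear : forall X Y : C, linear (@serre_dual X Y);
  serre_dual_bij : forall X Y : C, bijective (@serre_dual X Y);
  serre_dual_nat : forall (X X' Y Y' : C) (a : hom X X') (b : hom Y' Y)
      (g : hom Y (serre X)) (h : hom X' Y'),
    serre_dual (fmap serre a \oc g \oc b) h = serre_dual g (b \oc h \oc a);
  serre_eta : forall X : C, hom (serre (susp C X)) (susp C (serre X));
  serre_triangle : is_triangle_functor serre_eta;
  serre_etaE : forall (X Y : C) (f : hom Y (serre X))
      (g : hom (susp C Y) (serre (susp C X))) (h : hom X Y),
    serre_eta X \oc g = fmap (susp C) f ->
    serre_dual g (fmap (susp C) h) = - serre_dual f h
}.

(* S is a triangle functor with structure - id : S S -> S S, hence S^2 is one
   with structure + id : S^2 S -> S S^2. *)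
Definition calabi_yau2 (k : fieldType) (C : tricat k)
    (Sigma : serre_functor C) : Prop :=
  exists theta : forall X : C, hom (susp C (susp C X)) (Sigma X),
    @is_triangle_iso k C C (functor_comp (susp C) (susp C)) Sigma
      (fun X => idm (susp C (susp C (susp C X)))) (@serre_eta k C Sigma) theta.

Definition cluster_tilting (k : fieldType) (C : tricat k) (T : C) : Prop :=
  (forall f : hom T (susp C T), f = 0) /\
  (forall X : C, (forall f : hom X (susp C T), f = 0) -> in_add T X).

(* MathComp's [falgType] excludes the zero algebra, which occurs as the
   endomorphism algebra of a zero object. *)
Record fdalgebra (k : fieldType) := FdAlgebra {
  alg_vect :> vectType k;
  amul : alg_vect -> alg_vect -> alg_vect;
  aone : alg_vect;
  amulA : forall a b c, amul a (amul b c) = amul (amul a b) c;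
  amul1l : forall a, amul aone a = a;
  amul1r : forall a, amul a aone = a;
  amul_linearl : forall b, linear (fun a => amul a b);
  amul_linearr : forall a, linear (fun b => amul a b)
}.
Arguments amul {k f} a b.
Arguments aone {k f}.

Record rmodule (k : fieldType) (A : fdalgebra k) := RModule {
  rmod_vect :> vectType k;
  ract : rmod_vect -> A -> rmod_vect;
  ractM : forall m a b, ract m (amul a b) = ract (ract m a) b;
  ract1 : forall m, ract m aone = m;
  ract_linearl : forall a, linear (fun m => ract m a);
  ract_linearr : forall m, linear (fun a => ract m a)
}.
Arguments ract {k A r} m a.

Record rhom (k : fieldType) (A : fdalgebra k) (M N : rmodule A) := RHom {
  rhom_lin :> 'Hom(M, N);
  rhomM : forall (m : M) (a : A), rhom_lin (ract m a) = ract (rhom_lin m) a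
}.

Definition rmod_iso (k : fieldType) (A : fdalgebra k) (M N : rmodule A) : Prop :=
  exists f : rhom M N, bijective f.

Definition rsurj (k : fieldType) (A : fdalgebra k) (M N : rmodule A)
    (p : rhom M N) : Prop :=
  forall y : N, exists x : M, p x = y.

(* 0 -> M -i-> E -p-> N -> 0 is exact. *)
Definition short_exact (k : fieldType) (A : fdalgebra k) (M E N : rmodule A)
    (i : rhom M E) (p : rhom E N) : Prop :=
  [/\ injective i, rsurj p & forall x : E, p x = 0 <-> exists y : M, i y = x].

Definition rmod_regular (k : fieldType) (A : fdalgebra k) : rmodule A :=
  @RModule k A A (fun m a => amul m a) (@amulA k A) (@amul1r k A)
    (@amul_linearl k A) (@amul_linearr k A).

Section DirectSums.
Context (k : fieldType) (A : fdalgebra k).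

Section Sum.
Context (M N : rmodule A).
Let act (x : (M * N)%type) (a : A) : (M * N)%type := (ract x.1 a, ract x.2 a).

Lemma sum_actM x a b : act x (amul a b) = act (act x a) b.
Proof. by rewrite /act !ractM. Qed.

Lemma sum_act1 x : act x aone = x.
Proof. by case: x => m n; rewrite /act !ract1. Qed.

Lemma sum_act_linearl a : linear (fun x => act x a).
Proof. by move=> c x y; rewrite /act /= !ract_linearl. Qed.

Lemma sum_act_linearr x : linear (fun a => act x a).
Proof. by move=> c a b; rewrite /act !ract_linearr. Qed.

Definition rmod_sum : rmodule A :=
  RModule sum_actM sum_act1 sum_act_linearl sum_act_linearr.
End Sum.

Section Power.
Context (M : rmodule A) (n : nat).
Let act (x : {ffun 'I_n -> M}) (a : A) : {ffun 'I_n -> M} :=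
  [ffun i => ract (x i) a].

Lemma pow_actM x a b : act x (amul a b) = act (act x a) b.
Proof. by apply/ffunP=> i; rewrite !ffunE ractM. Qed.

Lemma pow_act1 x : act x aone = x.
Proof. by apply/ffunP=> i; rewrite !ffunE ract1. Qed.

Lemma pow_act_linearl a : linear (fun x => act x a).
Proof. by move=> c x y; apply/ffunP=> i; rewrite !ffunE ract_linearl. Qed.

Lemma pow_act_linearr x : linear (fun a => act x a).
Proof. by move=> c a b; apply/ffunP=> i; rewrite !ffunE ract_linearr. Qed.

Definition rmod_pow : rmodule A :=
  RModule pow_actM pow_act1 pow_act_linearl pow_act_linearr.
End Power.
End DirectSums.

Definition rmod_in_add (k : fieldType) (A : fdalgebra k) (L M : rmodule A) : Prop :=
  exists (n : nat) (M' : rmodule A), rmod_iso (rmod_sum M M') (rmod_pow L n).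

Definition rmod_projective (k : fieldType) (A : fdalgebra k) (P : rmodule A) : Prop :=
  forall (M N : rmodule A) (p : rhom M N) (f : rhom P N), rsurj p ->
    exists g : rhom P M, forall x : P, p (g x) = f x.

Definition pd_le1 (k : fieldType) (A : fdalgebra k) (M : rmodule A) : Prop :=
  exists (P1 P0 : rmodule A) (i : rhom P1 P0) (p : rhom P0 M),
    [/\ rmod_projective P1, rmod_projective P0 & short_exact i p].

(* Yoneda Ext^1_A(M, N) vanishes: every extension 0 -> N -> E -> M -> 0 splits. *)
Definition rmod_ext1_zero (k : fieldType) (A : fdalgebra k) (M N : rmodule A) : Prop :=
  forall (E : rmodule A) (i : rhom N E) (p : rhom E M), short_exact i p ->
    exists s : rhom M E, forall x : M, p (s x) = x.

Definition tilting_module (k : fieldType) (A : fdalgebra k) (L : rmodule A) : Prop :=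
  [/\ pd_le1 L,
      rmod_ext1_zero L L
    & exists (L0 L1 : rmodule A) (i : rhom (rmod_regular A) L0) (p : rhom L0 L1),
        [/\ rmod_in_add L L0, rmod_in_add L L1 & short_exact i p]].

Section EndAlgebra.
Context (k : fieldType) (C : lincat k) (T : C).

Definition end_algebra : fdalgebra k :=
  @FdAlgebra k (hom T T) (fun a b => a \oc b) (idm T)
    (@compA k C T T T T) (@comp1m k C T T) (@compm1 k C T T)
    (@comp_linearl k C T T T) (@comp_linearr k C T T T).

(* Hom_C(T, X) as a right End_C(T)-module, by precomposition. *)
Definition hom_rmodule (X : C) : rmodule end_algebra :=
  @RModule k end_algebra (hom T X) (fun (m : hom T X) (a : hom T T) => m \oc a)
    (fun m a b => @compA k C T T T X m a b) (@compm1 k C T X)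
    (@comp_linearl k C T T X) (@comp_linearr k C T T X).
End EndAlgebra.

(* Main.v *)
(* Write F = Hom_C(T, -).  Lift a projective resolution 0 -> P1 -> P0 -> L -> 0
   to a : Z1 -> Z0 in add T and let X be the cone of a, so that F X ~ L.

   X is rigid: Ext^1(L, L) = 0 makes every map Z1 -> X factor through a, so
   Hom(X, S X) -> Hom(Z0, S X) is injective; dually (2-Calabi-Yau) every map
   X -> S X factors through S Z0 -> S X, hence vanishes on Z0 because
   Hom(Z0, S Z0) = 0, hence vanishes.

   Composing End(T) -> L^0 with an embedding of L^0 in L^n gives t : T -> X^n
   with F t injective and with cone W such that F W is in add L.  Injectivity
   of F a and F t makes endomorphisms of W killed by F square to zero, so W is
   in add X.

   If Ext^1(Y, X) = 0, let P -> Y -> K be a triangle on a right add X-approximation.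
   Then Hom(X, K) = 0, and the triangle T -> X^n -> W -> S T forces Y -> K to
   vanish, so Y is a direct factor of P. *)
Require Import Defs.
From HB Require Import structures.
From mathcomp Require Import all_boot all_order all_algebra.

Import Defs.

Set Implicit Arguments.
Unset Strict Implicit.
Unset Printing Implicit Defensive.

Import GRing.Theory.
Local Open Scope ring_scope.
Local Open Scope lincat_scope.

(** * Linear categories and generation by an object *)

Section LinearCategories.
Context (k : fieldType) (C : lincat k).
Implicit Types X Y Z : C.

Lemma compDl X Y Z (g h : hom Y Z) (f : hom X Y) :
  (g + h) \oc f = g \oc f + h \oc f.
Proof. by have := comp_linearl f 1 g h; rewrite !scale1r. Qed.

Lemma compDr X Y Z (g : hom Y Z) (f h : hom X Y) :
  g \oc (f + h) = g \oc f + g \oc h.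
Proof. by have := comp_linearr g 1 f h; rewrite !scale1r. Qed.

Lemma comp0l X Y Z (f : hom X Y) : (0 : hom Y Z) \oc f = 0.
Proof. by apply: (addrI (0 \oc f)); rewrite -compDl !addr0. Qed.

Lemma comp0r X Y Z (g : hom Y Z) : g \oc (0 : hom X Y) = 0.
Proof. by apply: (addrI (g \oc 0)); rewrite -compDr !addr0. Qed.

Lemma compNl X Y Z (g : hom Y Z) (f : hom X Y) : (- g) \oc f = - (g \oc f).
Proof. by apply: (addrI (g \oc f)); rewrite -compDl !subrr comp0l. Qed.

Lemma compNr X Y Z (g : hom Y Z) (f : hom X Y) : g \oc (- f) = - (g \oc f).
Proof. by apply: (addrI (g \oc f)); rewrite -compDr !subrr comp0r. Qed.

Lemma compBl X Y Z (g h : hom Y Z) (f : hom X Y) :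
  (g - h) \oc f = g \oc f - h \oc f.
Proof. by rewrite compDl compNl. Qed.

Lemma compBr X Y Z (g : hom Y Z) (f h : hom X Y) :
  g \oc (f - h) = g \oc f - g \oc h.
Proof. by rewrite compDr compNr. Qed.

Lemma compZr X Y Z (a : k) (g : hom Y Z) (f : hom X Y) :
  g \oc (a *: f) = a *: (g \oc f).
Proof. by have := comp_linearr g a f 0; rewrite comp0r !addr0. Qed.

Lemma comp_suml (I : finType) X Y Z (g : I -> hom Y Z) (f : hom X Y) :
  (\sum_i g i) \oc f = \sum_i (g i \oc f).
Proof.
exact: (big_morph (fun g => g \oc f) (fun a b => compDl a b f) (comp0l _ _)).
Qed.

Lemma comp_sumr (I : finType) X Y Z (g : hom Y Z) (f : I -> hom X Y) :
  g \oc (\sum_i f i) = \sum_i (g \oc f i).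
Proof. exact: (big_morph (comp g) (compDr g) (comp0r _ _)). Qed.

(* [Y] is a direct factor of a finite power of [X]; no complement is named. *)
Definition gen_by X Y : Prop :=
  exists (I : finType) (u : I -> hom X Y) (v : I -> hom Y X),
    \sum_i (u i \oc v i) = idm Y.

Lemma gen_eq0l X Y Z (f : hom Y Z) :
  gen_by X Y -> (forall u : hom X Y, f \oc u = 0) -> f = 0.
Proof.
move=> [n [u [v uv1]]] fu0; rewrite -[f]compm1 -uv1 comp_sumr big1 // => i _.
by rewrite compA fu0 comp0l.
Qed.

Lemma gen_eq0r X Y Z (f : hom Z Y) :
  gen_by X Y -> (forall v : hom Y X, v \oc f = 0) -> f = 0.
Proof.
move=> [n [u [v uv1]]] vf0; rewrite -[f]comp1m -uv1 comp_suml big1 // => i _.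
by rewrite -compA vf0 comp0r.
Qed.

Lemma gen_by_refl X : gen_by X X.
Proof.
by exists 'I_1, (fun=> idm X), (fun=> idm X); rewrite big_ord1 comp1m.
Qed.

Lemma gen_retract X Y Z (s : hom Z Y) (r : hom Y Z) :
  r \oc s = idm Z -> gen_by X Y -> gen_by X Z.
Proof.
move=> rs1 [n [u [v uv1]]].
exists n, (fun i => r \oc u i), (fun i => v i \oc s).
rewrite -rs1 -[r in RHS]compm1 -uv1 comp_sumr comp_suml.
by apply: eq_bigr => i _; rewrite !compA.
Qed.

Lemma gen_power X n Y : is_direct_sum (fun _ : 'I_n => X) Y -> gen_by X Y.
Proof. by move=> [inj [prj [_ _ sum1]]]; exists 'I_n, inj, prj. Qed.

Lemma in_add_gen X Y : in_add X Y -> gen_by X Y.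
Proof.
move=> [n [P [/gen_power XP [Y' [inj [prj [id1 _ _]]]]]]].
exact: (gen_retract (id1 true) XP).
Qed.

(** The [u i] and [v i] make [Y] a retract of a power [P] of [X]; splitting the complementary
    idempotent [idm P - s \oc r] supplies the complement that [in_add] demands. *)
Lemma gen_in_add X Y :
  additive_cat C -> split_idempotents C -> gen_by X Y -> in_add X Y.
Proof.
move=> addC splitC [I [u' [v' uv1]]].
pose n := #|I|; pose u (i : 'I_n) := u' (enum_val i).
pose v (i : 'I_n) := v' (enum_val i).
have {}uv1 : \sum_i (u i \oc v i) = idm Y.
  by rewrite -uv1 [RHS](reindex _ (onW_bij _ (enum_val_bij I))).
have [P sumP] := addC n (fun=> X); exists n, P; split=> //.
have [inj [prj [id1 id0 sum1]]] := sumP.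
pose s := \sum_i (inj i \oc v i); pose r := \sum_i (u i \oc prj i).
have rs1 : r \oc s = idm Y.
  rewrite comp_suml -uv1; apply: eq_bigr => i _.
  rewrite comp_sumr (bigD1 i) //= big1 => [|j ji].
    by rewrite addr0 -compA [prj i \oc _]compA id1 comp1m.
  by rewrite -compA [prj i \oc _]compA id0 // comp0l comp0r.
pose e := idm P - s \oc r.
have re0 : r \oc e = 0 by rewrite compBr compm1 compA rs1 comp1m subrr.
have es0 : e \oc s = 0 by rewrite compBl comp1m -compA rs1 compm1 subrr.
have ee : e \oc e = e by rewrite {1}/e compBl comp1m -compA re0 comp0r subr0.
have [Y' [r' [s' [rs1' sre]]]] := splitC P e ee.
have r's0 : r' \oc s = 0.
  by rewrite -[r']comp1m -rs1' -[X in X \oc s]compA sre -compA es0 comp0r.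
have rs'0 : r \oc s' = 0.
  by rewrite -[s']compm1 -rs1' !compA -[r \oc s' \oc r']compA sre re0 comp0l.
exists Y', (fun b => if b return hom (if b then Y else Y') P then s else s'),
  (fun b => if b return hom P (if b then Y else Y') then r else r').
split=> [[]|[] []|] //.
by rewrite big_bool /= sre addrC subrK.
Qed.

(** By Hom-finiteness, one copy of [X] per vector of a basis of [hom X Y] is enough; the coordinates
    of [h] give the factorisation. *)
Lemma right_approx X Y : additive_cat C ->
  exists (P : C) (f : hom P Y), gen_by X P /\
    forall h : hom X Y, exists g : hom X P, h = f \oc g.
Proof.
move=> addC; pose e := vbasis {:hom X Y}.
have [P sumP] := addC _ (fun _ : 'I_(\dim {:hom X Y}) => X).
have [inj [prj [id1 id0 sum1]]] := sumP.
exists P, (\sum_(i < _) (e`_i \oc prj i)); split=> [|h]; first exact: gen_power sumP.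
exists (\sum_i (coord e i h *: inj i)).
rewrite [LHS](coord_vbasis (memvf h)) comp_suml; apply: eq_bigr => i _.
rewrite comp_sumr (bigD1 i) //= big1 => [|j ji].
  by rewrite addr0 compZr -compA id1 compm1.
by rewrite compZr -compA id0 // comp0r scaler0.
Qed.

Lemma binary_sum X Y : additive_cat C ->
  exists (D : C) (i1 : hom X D) (i2 : hom Y D) (p1 : hom D X) (p2 : hom D Y),
    [/\ p1 \oc i1 = idm X, p2 \oc i2 = idm Y, p2 \oc i1 = 0, p1 \oc i2 = 0
      & i1 \oc p1 + i2 \oc p2 = idm D].
Proof.
move=> addC.
have [D [inj [prj [id1 id0 sum1]]]] :=
  addC 2%N (fun i : 'I_2 => if val i is 0 then X else Y).
pose o1 : 'I_2 := lift ord0 ord0.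
exists D, (inj ord0), (inj o1), (prj ord0), (prj o1); split.
- exact: (id1 ord0).
- exact: (id1 o1).
- exact: (id0 ord0 o1).
- exact: (id0 o1 ord0).
- by rewrite -sum1 big_ord_recl big_ord1.
Qed.

End LinearCategories.

(** * Linear functors and equivalences *)

Section Functors.
Context (k : fieldType) (C D : lincat k) (F : linfunctor C D).
Implicit Types X Y : C.

Lemma fmapD X Y (f g : hom X Y) : fmap F (f + g) = fmap F f + fmap F g.
Proof. by have := fmap_linear F 1 f g; rewrite !scale1r. Qed.

Lemma fmap0 X Y : fmap F (0 : hom X Y) = 0.
Proof. by apply: (addrI (fmap F 0)); rewrite -fmapD !addr0. Qed.

Lemma fmapN X Y (f : hom X Y) : fmap F (- f) = - fmap F f.
Proof. by apply: (addrI (fmap F f)); rewrite -fmapD !subrr fmap0. Qed.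

Lemma fmap_sum (I : finType) X Y (f : I -> hom X Y) :
  fmap F (\sum_i f i) = \sum_i fmap F (f i).
Proof. exact: (big_morph (@fmap _ _ _ F X Y) (@fmapD X Y) (@fmap0 X Y)). Qed.

Lemma gen_fmap X Y : gen_by X Y -> gen_by (F X) (F Y).
Proof.
move=> [n [u [v uv1]]]; exists n, (fun i => fmap F (u i)), (fun i => fmap F (v i)).
by rewrite -fmap1 -uv1 fmap_sum; apply: eq_bigr => i _; rewrite fmap_comp.
Qed.

End Functors.

Lemma iso_comp0l (k : fieldType) (E : lincat k) (X Y Z : E) (i : hom X Y) (f : hom Y Z) :
  is_iso i -> f \oc i = 0 -> f = 0.
Proof. by move=> [j [_ ij]] fi; rewrite -[f]compm1 -ij compA fi comp0l. Qed.

Lemma iso_comp0r (k : fieldType) (E : lincat k) (X Y Z : E) (i : hom X Y) (f : hom Z X) :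
  is_iso i -> i \oc f = 0 -> f = 0.
Proof. by move=> [j [ji _]] fi; rewrite -[f]comp1m -ji -compA fi comp0r. Qed.

(** Stated for a one-sided inverse so that it serves both an equivalence and its quasi-inverse;
    fullness rests on the latter. *)
Lemma left_inv_faithful (k : fieldType) (C D : lincat k)
    (F : linfunctor C D) (G : linfunctor D C) (eta : forall X : C, hom (G (F X)) X) :
  @is_natural_iso k C C (functor_comp G F) (functor_id C) eta ->
  forall (X Y : C) (f : hom X Y), fmap F f = 0 -> f = 0.
Proof.
move=> [nat iso] X Y f Ff0; have /= nf := nat X Y f.
by apply: (iso_comp0l (iso X)); rewrite -nf Ff0 fmap0 comp0r.
Qed.

Lemma equiv_faithful (k : fieldType) (C D : lincat k) (F : linfunctor C D) :
  is_equivalence F -> forall (X Y : C) (f : hom X Y), fmap F f = 0 -> f = 0.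
Proof. by move=> [G [[eta eta_iso] _]]; apply: left_inv_faithful eta_iso. Qed.

Lemma equiv_full (k : fieldType) (C D : lincat k) (F : linfunctor C D) :
  is_equivalence F ->
  forall (X Y : C) (h : hom (F X) (F Y)), exists f : hom X Y, fmap F f = h.
Proof.
move=> [G [[eta [nat iso]] [eps eps_iso]]] X Y h.
have [j [ji ij]] := iso X.
pose f := eta Y \oc fmap G h \oc j; exists f; apply: subr0_eq.
apply: (left_inv_faithful eps_iso).
apply: (iso_comp0r (iso Y)); have /= := nat X Y f.
by rewrite fmapD fmapN compBr => ->; rewrite -[f \oc _]compA ji compm1 subrr.
Qed.

(** * Exactness properties of distinguished triangles *)

Section Triangles.
Context (k : fieldType) (C : tricat k).
Implicit Types X Y Z : C.
Local Notation S := (susp C).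

Definition susp_faithful := equiv_faithful (susp_equiv C).
Definition susp_full := equiv_full (susp_equiv C).

Lemma zero_object : exists Z : C, is_zero_obj Z.
Proof.
have [Z [inj [prj [_ _ sum0]]]] :=
  tri_additive (fun i : 'I_0 => False_rect C (notF (ltn_ord i))).
by exists Z; rewrite /is_zero_obj -sum0 big_ord0.
Qed.

Section Exactness.
Context (X Y Z : C) (u : hom X Y) (v : hom Y Z) (w : hom Z (S X)).
Hypothesis uvw : dist u v w.

Lemma dist_comp0 : v \oc u = 0.
Proof.
have [O O0] := zero_object.
have idu : u \oc idm X = u \oc idm X by [].
have [c [/= vu _]] := dist_morph (dist_idm X O0) uvw idu.
by rewrite -vu comp0r.
Qed.

Lemma dist_extend (A : C) (f : hom Y A) :
  f \oc u = 0 -> exists g : hom Z A, f = g \oc v.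
Proof.
move=> fu0; have [O O0] := zero_object.
have SO0 : is_zero_obj (S O) by rewrite /is_zero_obj -fmap1 O0 fmap0.
have OAA : dist (0 : hom O A) (idm A) (0 : hom A (S O)).
  by apply/dist_rot; rewrite fmap0 oppr0; apply: dist_idm.
have sq : f \oc u = 0 \oc (0 : hom X O) by rewrite fu0 comp0r.
have [g [gv _]] := dist_morph uvw OAA sq.
by exists g; rewrite gv comp1m.
Qed.

(** TR3 completes only the third map of a morphism, so both triangles are rotated first; the
    resulting map [S A -> S X] is then desuspended. *)
Lemma dist_lift (A : C) (f : hom A Y) :
  v \oc f = 0 -> exists g : hom A X, f = u \oc g.
Proof.
move=> vf0; have [O O0] := zero_object.
have /dist_rot tri_A := dist_idm A O0.
have /dist_rot tri_X := uvw.
have sq : (0 : hom O Z) \oc (0 : hom A O) = v \oc f by rewrite vf0 comp0r.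
have [c [_ Sf]] := dist_morph tri_A tri_X sq.
have [g Sg] := susp_full c.
exists g; apply: subr0_eq; apply: susp_faithful.
move: Sf; rewrite fmap1 compNl compNr compm1 => /oppr_inj Sf.
by rewrite fmapD fmapN Sf -Sg fmap_comp subrr.
Qed.

End Exactness.

Lemma dist_rotate X Y Z (u : hom X Y) (v : hom Y Z) (w : hom Z (S X)) :
  dist u v w -> dist v w (- fmap S u).
Proof. by move/dist_rot. Qed.

(** The cone [K] of [v] has to be desuspended: it is replaced by the isomorphic [S (G K)], and [u]
    is negated to cancel the sign in TR2. *)
Lemma dist_cocone Y Z (v : hom Y Z) :
  exists (X : C) (u : hom X Y) (w : hom Z (S X)), dist u v w.
Proof.
have [K [p [q vpq]]] := dist_cone v.
have [G [_ [eps [_ eps_iso]]]] := susp_equiv C.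
have [j [ji ij]] := eps_iso K; rewrite /= in j ji ij *.
have [u Su] := susp_full (q \oc eps K).
exists (G K), (- u), (j \oc p); apply/dist_rot.
apply: (dist_iso (a := idm Y) (b := idm Z) (c := j)) vpq.
- by exists (idm Y); rewrite compm1.
- by exists (idm Z); rewrite compm1.
- by exists (eps K).
- by rewrite comp1m compm1.
- by rewrite compm1.
- by rewrite fmap1 comp1m fmapN opprK Su -compA ij compm1.
Qed.

End Triangles.

(** * Finite-dimensional linear algebra *)

Lemma lfun_of_linear (k : fieldType) (V W : vectType k) (f : V -> W) :
  linear f -> {g : 'Hom(V, W) | g =1 f}.
Proof.
move=> lin_f.
pose f' : {linear V -> W} := HB.pack f (GRing.isLinear.Build k V W *:%R f lin_f).
by exists (linfun f') => x; rewrite lfunE.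
Qed.

Lemma lfun_surj (k : fieldType) (V W : vectType k) (f : 'Hom(V, W)) :
  (forall phi : 'Hom(W, k^o), (forall x, phi (f x) = 0) -> phi = 0) ->
  forall y : W, exists x : V, y = f x.
Proof.
(* [f^-1] is a right inverse of [f] on its image, so [d] kills that image and its coordinates are
   functionals to which the hypothesis applies. *)
move=> f_dense y; pose d := (\1 - (f \o f^-1))%VF.
have dE w : d w = w - f (f^-1%VF w) by rewrite add_lfunE opp_lfunE id_lfunE comp_lfunE.
exists (f^-1%VF y); apply: subr0_eq; rewrite -dE.
rewrite (coord_vbasis (memvf (d y))) big1 // => i _.
have [phi phiE] : {phi : 'Hom(W, k^o) | phi =1
    (fun w => coord (vbasis {:W}) i (d w) : k^o)}.
  by apply: lfun_of_linear => a u v; rewrite !linearP.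
suff phi0 : phi = 0 by rewrite -phiE phi0 lfunE scale0r.
apply: f_dense => x; rewrite phiE dE limg_lfunVK ?memv_img ?memvf //.
by rewrite subrr linear0.
Qed.

(** * Duality in a 2-Calabi-Yau category *)

Section CalabiYau.
Context (k : fieldType) (C : tricat k) (Sigma : serre_functor C).
Hypothesis CY : calabi_yau2 Sigma.
Local Notation S := (susp C).

(** By Serre duality, a functional on [hom Y (S X)] killing the image of [fmap S b] is a map
    [g : S X -> Sigma Y] with [g \oc fmap S b = 0]. Since [Sigma Y] is isomorphic to [S (S Y)], [g]
    desuspends to a map [X -> S Y] killed by [b]. *)
Lemma cy_surjective (A X Y : C) (b : hom A X) :
  (forall g : hom X (S Y), g \oc b = 0 -> g = 0) ->
  forall f : hom Y (S X), exists h : hom Y (S A), f = fmap S b \oc h.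
Proof.
move=> inj_b; have [theta [[nat iso] _]] := CY.
have [Sb SbE] := lfun_of_linear (@comp_linearr k C Y (S A) (S X) (fmap S b)).
suff Sb_surj f : exists h, f = Sb h.
  by move=> f; have [h ->] := Sb_surj f; exists h.
apply: lfun_surj => phi phi0.
have [dual _ dualK] := serre_dual_bij Sigma Y (S X).
rewrite -(dualK phi) in phi0 *; set g := dual phi in phi0 *.
have dual0 Z : serre_dual (s := Sigma) (0 : hom Z (Sigma Y)) = 0.
  have := @serre_dual_linear k C Sigma Y Z (-1) 0 0.
  by rewrite scaler0 addr0 scaleN1r addNr.
suff -> : g = 0 by [].
have gSb0 : g \oc fmap S b = 0.
  have [dual' dual'K _] := serre_dual_bij Sigma Y (S A).
  apply: (can_inj dual'K); rewrite dual0; apply/lfunP => h.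
  rewrite -[g]comp1m -fmap1 serre_dual_nat compm1 lfunE /=.
  by rewrite -[RHS](phi0 h) SbE.
have [j [ji ij]] := iso Y; rewrite /= in j ji ij *.
have [g' Sg'] := susp_full (j \oc g).
have -> : g = theta Y \oc fmap S g' by rewrite Sg' compA ij comp1m.
rewrite (inj_b g') ?fmap0 ?comp0r //.
by apply: susp_faithful; rewrite fmap_comp Sg' -compA gSb0 comp0r.
Qed.

(** Restriction along the zero map is injective exactly when its source vanishes, so this is the
    case [b = 0] of [cy_surjective]. *)
Lemma cy_ext1_sym (X Y : C) :
  (forall g : hom X (S Y), g = 0) -> forall f : hom Y (S X), f = 0.
Proof.
move=> XY0 f; have [h ->] := cy_surjective (b := 0 : hom X X) (fun g _ => XY0 g) f.
by rewrite fmap0 comp0l.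
Qed.

End CalabiYau.

(** * Modules over a finite-dimensional algebra *)

Section Modules.
Context (k : fieldType) (A : fdalgebra k).
Implicit Types M N P : rmodule A.

Lemma ract0 M (a : A) : ract (0 : M) a = 0.
Proof.
by have := ract_linearl a (-1) (0 : M) 0; rewrite scaler0 addr0 scaleN1r addNr.
Qed.

Lemma ract_suml M (I : finType) (f : I -> M) (a : A) :
  ract (\sum_i f i) a = \sum_i ract (f i) a.
Proof.
apply: (big_morph (fun m => ract m a) _ (ract0 M a)) => x y.
by have := ract_linearl a 1 x y; rewrite !scale1r.
Qed.

Lemma ractZr M (m : M) (c : k) (a : A) : ract m (c *: a) = c *: ract m a.
Proof.
have := ract_linearr m (-1) 0 0; rewrite scaler0 addr0 scaleN1r addNr => m0.
by have := ract_linearr m c a 0; rewrite m0 !addr0.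
Qed.

Lemma rhom_of_linear M N (f : M -> N) :
  linear f -> (forall m a, f (ract m a) = ract (f m) a) ->
  {g : rhom M N | g =1 f}.
Proof.
move=> lin_f act_f; have [g gE] := lfun_of_linear lin_f.
have gM m a : g (ract m a) = ract (g m) a by rewrite !gE act_f.
by exists (RHom gM).
Qed.

Lemma rhom_comp M N P (g : rhom N P) (f : rhom M N) :
  {h : rhom M P | forall x, h x = g (f x)}.
Proof.
by apply: rhom_of_linear => [a x y|m a]; rewrite ?linearP // !rhomM.
Qed.

(** The linear pseudo-inverse of [q] need not respect the action, but [p] after it does: by the
    kernel condition [p] does not depend on the chosen preimage. *)
Lemma rhom_factor P M N (q : rhom P M) (p : rhom P N) :
  rsurj q -> (forall x, q x = 0 -> p x = 0) ->
  exists h : rhom M N, forall x, h (q x) = p x.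
Proof.
move=> q_surj ker_qp.
have qVK y : q ((rhom_lin q)^-1%VF y) = y.
  by have [x <-] := q_surj y; rewrite limg_lfunVK // memv_img ?memvf.
have p_eq x y : q x = q y -> p x = p y.
  move=> qxy; have := ker_qp (x - y).
  by rewrite !linearB /= qxy subrr => /(_ erefl)/subr0_eq.
have [h hE] : {h : rhom M N | h =1 (fun y => p ((rhom_lin q)^-1%VF y))}.
  apply: rhom_of_linear => [a x y|m a].
    by rewrite -[RHS]linearP /=; apply: p_eq; rewrite [RHS]linearP /= !qVK.
  by rewrite -rhomM; apply: p_eq; rewrite rhomM !qVK.
by exists h => x; rewrite hE; apply: p_eq; rewrite qVK.
Qed.

Lemma rhom_inverse M N (f : rhom M N) : bijective f ->
  exists g : rhom N M, cancel f g /\ cancel g f.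
Proof.
move=> [g fK gK].
have [h hE] : {h : rhom N M | h =1 g}.
  apply: rhom_of_linear => [a x y|m a]; apply: (can_inj fK).
    by rewrite [RHS]linearP /= !gK.
  by rewrite rhomM !gK.
by exists h; split=> x; rewrite hE ?fK ?gK.
Qed.

(** Module counterpart of [gen_by], in a form that lifts to the category one homomorphism at a
    time. *)
Definition rgen_by M N : Prop :=
  exists (I : finType) (u : I -> rhom M N) (v : I -> rhom N M),
    forall x, \sum_i u i (v i x) = x.

Lemma rgen_retract N M P (s : rhom M P) (r : rhom P M) :
  cancel s r -> rgen_by N P -> rgen_by N M.
Proof.
move=> sK [n [u [v uv1]]].
exists n, (fun i => sval (rhom_comp r (u i))), (fun i => sval (rhom_comp (v i) s)).
move=> x; rewrite -[RHS]sK -(uv1 (s x)) linear_sum /=.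
by apply: eq_bigr => i _; case: rhom_comp => ? ->; case: rhom_comp => ? ->.
Qed.

Lemma rgen_split N M M1 M2 (e1 : rhom M M1) (d1 : rhom M1 M)
    (e2 : rhom M M2) (d2 : rhom M2 M) :
  (forall x, d1 (e1 x) + d2 (e2 x) = x) ->
  rgen_by N M1 -> rgen_by N M2 -> rgen_by N M.
Proof.
move=> de1 [I [u [v uv1]]] [I' [u' [v' uv1']]].
exists (I + I')%type,
  (fun i => match i with inl j => sval (rhom_comp d1 (u j))
                       | inr j => sval (rhom_comp d2 (u' j)) end),
  (fun i => match i with inl j => sval (rhom_comp (v j) e1)
                       | inr j => sval (rhom_comp (v' j) e2) end).
move=> x; rewrite big_sumType /= -[RHS]de1 -(uv1 (e1 x)) -(uv1' (e2 x)) !linear_sum /=.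
by congr (_ + _); apply: eq_bigr => i _; case: rhom_comp => ? ->; case: rhom_comp => ? ->.
Qed.

Lemma rgen_iso N N' M (f : rhom N N') (g : rhom N' N) :
  cancel g f -> rgen_by N' M -> rgen_by N M.
Proof.
move=> gK [I [u [v uv1]]].
exists I, (fun i => sval (rhom_comp (u i) f)), (fun i => sval (rhom_comp g (v i))).
move=> x; rewrite -[RHS]uv1; apply: eq_bigr => i _.
by case: rhom_comp => ? ->; case: rhom_comp => ? ->; rewrite gK.
Qed.

Lemma rgen_pow M n : rgen_by M (rmod_pow M n).
Proof.
have in_P (i : 'I_n) : {g : rhom M (rmod_pow M n) |
    g =1 (fun x => [ffun j => if j == i then x else 0])}.
  apply: rhom_of_linear => [a x y|m a]; apply/ffunP=> j; rewrite !ffunE.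
    by case: ifP => _; rewrite ?scaler0 ?addr0.
  by case: ifP => _; rewrite ?ract0.
have pr_P (i : 'I_n) : {g : rhom (rmod_pow M n) M |
    g =1 (fun x : {ffun 'I_n -> M} => x i)}.
  by apply: rhom_of_linear => [a x y|m a]; rewrite !ffunE.
exists 'I_n, (fun i => sval (in_P i)), (fun i => sval (pr_P i)) => x.
apply/ffunP=> j; rewrite sum_ffunE (bigD1 j) //= big1 => [|i ij].
  by case: in_P => ? /= ->; case: pr_P => ? /= ->; rewrite ffunE eqxx addr0.
by case: in_P => ? /= ->; rewrite ffunE eq_sym (negbTE ij).
Qed.

Lemma sum_projections M N :
  exists (i1 : rhom M (rmod_sum M N)) (i2 : rhom N (rmod_sum M N))
    (p1 : rhom (rmod_sum M N) M) (p2 : rhom (rmod_sum M N) N),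
    [/\ cancel i1 p1, cancel i2 p2, forall x, p2 (i1 x) = 0,
        forall x, p1 (i2 x) = 0 & forall x, i1 (p1 x) + i2 (p2 x) = x].
Proof.
have [i1 i1E] : {g : rhom M (rmod_sum M N) | g =1 (fun x => (x, 0) : M * N)}.
  by apply: rhom_of_linear => [a x y|m a]; apply: injective_projections;
    rewrite /= ?scaler0 ?addr0 ?ract0.
have [i2 i2E] : {g : rhom N (rmod_sum M N) | g =1 (fun x => (0, x) : M * N)}.
  by apply: rhom_of_linear => [a x y|m a]; apply: injective_projections;
    rewrite /= ?scaler0 ?addr0 ?ract0.
have [p1 p1E] : {g : rhom (rmod_sum M N) M | g =1 (fun x : M * N => x.1)}.
  exact: rhom_of_linear.
have [p2 p2E] : {g : rhom (rmod_sum M N) N | g =1 (fun x : M * N => x.2)}.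
  exact: rhom_of_linear.
exists i1, i2, p1, p2; split=> x; rewrite ?p1E ?p2E ?i1E ?i2E //.
by apply: injective_projections; rewrite /= ?addr0 ?add0r.
Qed.

Lemma in_add_rgen N M M' n : rmod_iso (rmod_sum M M') (rmod_pow N n) ->
  rgen_by N M /\ rgen_by N M'.
Proof.
move=> [f /rhom_inverse [g [fK _]]].
have [i1 [i2 [p1 [p2 [i1K i2K _ _ _]]]]] := sum_projections M M'.
have sumP := rgen_retract fK (rgen_pow N n).
by split; [apply: rgen_retract i1K sumP | apply: rgen_retract i2K sumP].
Qed.

Lemma rmod_ext1_zero_iso M N (f : rhom M N) (g : rhom N M) :
  cancel f g -> cancel g f -> rmod_ext1_zero N N -> rmod_ext1_zero M M.
Proof.
move=> fK gK extN E i p [i_inj p_surj exE].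
have [i' i'E] := rhom_comp i g; have [p' p'E] := rhom_comp f p.
have [|s sE] := extN E i' p'.
  split=> [x y|y|x].
  - by rewrite !i'E => /i_inj/(can_inj gK).
  - by have [x xE] := p_surj (g y); exists x; rewrite p'E xE gK.
  rewrite p'E; split=> [fpx0|[y <-]].
    have [|y yE] := (exE x).1; first by rewrite -[p x]fK fpx0 linear0.
    by exists (f y); rewrite i'E fK.
  by rewrite i'E (exE _).2 ?linear0 //; exists (g y).
have [s' s'E] := rhom_comp s f.
by exists s' => x; apply: (can_inj fK); rewrite s'E -p'E sE.
Qed.

End Modules.

(** * The functor [Hom(T, -)] and its behaviour on [add T] *)

Section HomModules.
Context (k : fieldType) (C : lincat k) (T : C).
Implicit Types X Y Z : C.
Local Notation F := (hom_rmodule T).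

Lemma gen_lift X Y Z (f : hom Z Y) (j : hom X Y) :
  gen_by T Z -> (forall u : hom T Z, exists r : hom T X, f \oc u = j \oc r) ->
  exists r : hom Z X, f = j \oc r.
Proof.
move=> [I [u [v uv1]]] fu.
have [r rE] := fin_all_exists (fun i => fu (u i)).
exists (\sum_i (r i \oc v i)).
rewrite comp_sumr -[LHS]compm1 -uv1 comp_sumr; apply: eq_bigr => i _.
by rewrite !compA rE.
Qed.

Lemma gen_hom0 X X' Y Y' : gen_by X X' -> gen_by Y Y' ->
  (forall f : hom X Y, f = 0) -> forall f : hom X' Y', f = 0.
Proof.
move=> XX' YY' XY0 f; apply: (gen_eq0l XX') => u.
by apply: (gen_eq0r YY') => v.
Qed.

Lemma hom_post X Y (h : hom X Y) :
  {f : rhom (F X) (F Y) | forall z : hom T X, f z = h \oc z}.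
Proof.
apply: rhom_of_linear => [a x y|m a]; last by rewrite /= compA.
exact: comp_linearr.
Qed.

(** Yoneda passes from [T] to direct factors of its powers: the images of the [u i] under [phi] are
    reassembled along the [v i]. *)
Lemma yoneda Z X (phi : rhom (F Z) (F X)) : gen_by T Z ->
  exists g : hom Z X, forall z : hom T Z, phi z = g \oc z.
Proof.
move=> [I [u [v uv1]]].
exists (\sum_i ((phi (u i) : hom T X) \oc v i)) => z.
rewrite -{1}[z]comp1m -uv1 !comp_suml [LHS](linear_sum phi).
apply: eq_bigr => i _; rewrite -!compA; exact: (rhomM phi (u i) (v i \oc z)).
Qed.

(** A surjection from [F B], with [B] a power of [T], splits by projectivity; the resulting
    idempotent of [F B] is composition with an idempotent [f] of [B], and [Z] is the image of
    [f]. *)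
Lemma projective_lift (P : rmodule (end_algebra T)) :
  additive_cat C -> split_idempotents C -> rmod_projective P ->
  exists Z : C, gen_by T Z /\ exists phi : rhom (F Z) P, bijective phi.
Proof.
move=> addC splitC projP.
have [B sumB] := addC _ (fun _ : 'I_(\dim {:P}) => T).
have [inj [prj [id1 id0 sum1]]] := sumB.
have genB := gen_power sumB.
pose e := vbasis {:P}.
have [p pE] : {p : rhom (F B) P |
    p =1 (fun y : hom T B => \sum_(i < _) ract e`_i (prj i \oc y))}.
  apply: rhom_of_linear => [a x y|y a].
    rewrite scaler_sumr -big_split; apply: eq_bigr => i _ /=.
    by rewrite (comp_linearr (prj i)) ract_linearr.
  by rewrite ract_suml; apply: eq_bigr => i _; rewrite -ractM compA.
have p_surj : rsurj p.
  move=> y; exists (\sum_(i < _) coord e i y *: inj i : hom T B).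
  rewrite pE [RHS](coord_vbasis (memvf y)); apply: eq_bigr => i _.
  rewrite comp_sumr (bigD1 i) //= big1 => [|j ji].
    by rewrite addr0 compZr id1 ractZr; congr (_ *: _); apply: ract1.
  by rewrite compZr id0 // scaler0.
have [idP idPE] : {f : rhom P P | f =1 id} by apply: rhom_of_linear.
have [s sE] := projP _ _ p idP p_surj.
have {idP idPE}sE y : p (s y) = y by rewrite sE idPE.
have [sp spE] := rhom_comp s p.
have [f fE] := yoneda sp genB.
have {}fE z : s (p z) = f \oc z by rewrite -spE fE.
have ff : f \oc f = f.
  apply: subr0_eq; apply: (gen_eq0l genB) => u.
  by rewrite compBl -compA -!fE sE subrr.
have [Z [r [t [rt tr]]]] := splitC B f ff.
exists Z; split; first exact: (gen_retract rt genB).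
have [tF tE] := hom_post t; have [phi phiE] := rhom_comp p tF.
exists phi; exists (fun y => r \oc (s y : hom T B)) => [z|y].
  by rewrite phiE tE fE -tr !compA rt comp1m rt comp1m.
by rewrite phiE tE compA tr -fE !sE.
Qed.

Lemma hom_rmodule_pow X B n (L : rmodule (end_algebra T))
    (h : rhom (F X) L) (h' : rhom L (F X)) :
  is_direct_sum (fun _ : 'I_n => X) B -> cancel h h' -> cancel h' h ->
  exists (f : rhom (F B) (rmod_pow L n)) (g : rhom (rmod_pow L n) (F B)),
    cancel f g /\ cancel g f.
Proof.
move=> [inj [prj [id1 id0 sum1]]] hK h'K.
have [f fE] : {f : rhom (F B) (rmod_pow L n) |
    f =1 (fun y : hom T B => [ffun j => h (prj j \oc y)])}.
  apply: rhom_of_linear => [a x y|y a]; apply/ffunP=> j; rewrite !ffunE.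
    by rewrite (comp_linearr (prj j)) (linearP h).
  by rewrite compA (rhomM h).
pose g (x : rmod_pow L n) : hom T B := \sum_j (inj j \oc (h' (x j) : hom T X)).
have fK : cancel f g.
  move=> y; rewrite /g -[RHS]comp1m -sum1 comp_suml; apply: eq_bigr => j _.
  by rewrite fE ffunE hK compA.
have gK : cancel g f.
  move=> x; rewrite fE; apply/ffunP=> j; rewrite ffunE -[RHS]h'K; congr (h _).
  rewrite comp_sumr (bigD1 j) //= big1 => [|i ij].
    by rewrite addr0 compA id1 comp1m.
  by rewrite compA id0 // comp0l.
have [g' [fK' g'K]] := rhom_inverse (Bijective fK gK).
by exists f, g'.
Qed.

End HomModules.

(** * Presentations by [add T] and morphisms of [Hom(T, -)] modules *)

Section ClusterTilting.
Context (k : fieldType) (C : tricat k) (T : C).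
Hypothesis splitC : split_idempotents C.
Local Notation S := (susp C).
Local Notation F := (hom_rmodule T).
Implicit Types X Y Z : C.

(** [T1] is in [add T] because [Hom(T, S T1) = 0]: a map [T -> S T1] dies in [S T0] by rigidity, so
    it is [c] after a map [T -> Y], which factors through the approximation [b], and
    [c \oc b = 0]. *)
Lemma presentation (Sigma : serre_functor C) (Y : C) :
  calabi_yau2 Sigma -> cluster_tilting T ->
  exists (T1 T0 : C) (a : hom T1 T0) (b : hom T0 Y) (c : hom Y (S T1)),
    [/\ dist a b c, gen_by T T1 & gen_by T T0].
Proof.
move=> CY [T_rigid T_max].
have [T0 [b [genT0 b_approx]]] := right_approx T Y (@tri_additive _ C).
have [T1 [a [c abc]]] := dist_cocone b.
exists T1, T0, a, b, c; split=> //; apply: in_add_gen; apply: T_max.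
apply: (cy_ext1_sym CY) => h.
have bcSa := dist_rotate abc; have cSab := dist_rotate bcSa.
have Sah : (- fmap S a) \oc h = 0.
  exact: (gen_hom0 (gen_by_refl T) (gen_fmap S genT0) T_rigid).
have [h' ->] := dist_lift cSab Sah.
have [g ->] := b_approx h'.
by rewrite compA (dist_comp0 bcSa) comp0l.
Qed.

Hypothesis T_rigid : forall f : hom T (S T), f = 0.
Hypothesis presT : forall Y : C,
  exists (T1 T0 : C) (a : hom T1 T0) (b : hom T0 Y) (c : hom Y (S T1)),
    [/\ dist a b c, gen_by T T1 & gen_by T T0].

Lemma gen_rigid Z Z' : gen_by T Z -> gen_by T Z' -> forall f : hom Z (S Z'), f = 0.
Proof. by move=> TZ TZ'; apply: (gen_hom0 TZ (gen_fmap S TZ')). Qed.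

(** Yoneda on [T0] gives a map [g] killing [a], which extends to [W]. The extension induces [phi]
    because [F b] is onto, as [Hom(T, S T1) = 0]. *)
Lemma hom_rmodule_full W X (phi : rhom (F W) (F X)) :
  exists h : hom W X, forall z : hom T W, phi z = h \oc z.
Proof.
have [T1 [T0 [a [b [c [abc T1gen T0gen]]]]]] := presT W.
have [bF bE] := hom_post T b; have [pb pbE] := rhom_comp phi bF.
have [g gE] := yoneda pb T0gen.
have ga0 : g \oc a = 0.
  apply: (gen_eq0l T1gen) => u.
  by rewrite -compA -gE pbE bE compA (dist_comp0 abc) comp0l linear0.
have [h hE] := dist_extend abc ga0.
exists h => z.
have [z' ->] := dist_lift (dist_rotate abc) (gen_rigid (gen_by_refl T) T1gen (c \oc z)).
by rewrite -{1}bE -pbE gE hE compA.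
Qed.

(** Such an [h] vanishes on [T0], hence factors through [c]. With [hom_rmodule_full] this is the
    part of the Keller-Reiten equivalence used below. *)
Lemma hom_rmodule_kernel W X (h : hom W X) :
  (forall z : hom T W, h \oc z = 0) ->
  exists (T1 : C) (u : hom W (S T1)) (v : hom (S T1) X),
    gen_by T T1 /\ h = v \oc u.
Proof.
move=> h0; have [T1 [T0 [a [b [c [abc T1gen T0gen]]]]]] := presT W.
have hb0 : h \oc b = 0 by apply: (gen_eq0l T0gen) => u; rewrite -compA h0.
have [v ->] := dist_extend (dist_rotate abc) hb0.
by exists T1, c, v.
Qed.

(** * Rigidity of the cone of a lifted projective resolution *)

Section Rigidity.
Context (Z1 Z0 X : C) (a : hom Z1 Z0) (b : hom Z0 X) (c : hom X (S Z1)).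
Hypotheses (abc : dist a b c) (Z1gen : gen_by T Z1) (Z0gen : gen_by T Z0).
Hypothesis a_inj : forall w : hom T Z1, a \oc w = 0 -> w = 0.
Hypothesis X_ext : rmod_ext1_zero (F X) (F X).

(** The cone [E] of [d : Z1 -> D], with [D] the sum of [X] and [Z0], is a homotopy pushout of [g]
    and [a]. Injectivity of [F a] makes [F E] an extension of [F X] by itself, and a splitting of it
    yields [r]. *)
Lemma extend_along_presentation (g : hom Z1 X) : exists r : hom Z0 X, g = r \oc a.
Proof.
have [D [i1 [i2 [p1 [p2 [pi1 pi2 pi21 pi12 ip]]]]]] :=
  binary_sum X Z0 (@tri_additive _ C).
pose d := i1 \oc g - i2 \oc a.
have [E [e [w dew]]] := dist_cone d.
have bp2d : (b \oc p2) \oc d = 0.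
  rewrite compBr -!compA [p2 \oc (i1 \oc g)]compA [p2 \oc (i2 \oc a)]compA.
  by rewrite pi21 pi2 comp0l comp1m comp0r (dist_comp0 abc) subrr.
have [q qE] := dist_extend dew bp2d.
pose j1 := e \oc i1; pose j2 := e \oc i2.
have qj1 : q \oc j1 = 0 by rewrite compA -qE -compA pi21 comp0r.
have qj2 : q \oc j2 = b by rewrite compA -qE -compA pi2 compm1.
have j12 : j1 \oc g = j2 \oc a.
  by apply: subr0_eq; rewrite -!compA -compBr (dist_comp0 dew).
have j1_inj (x : hom T X) : j1 \oc x = 0 -> x = 0.
  rewrite -compA => /(dist_lift dew) [z zE].
  have p2d : p2 \oc d = - a.
    by rewrite compBr !compA pi21 pi2 comp0l comp1m sub0r.
  have z0 : z = 0.
    apply: a_inj; apply: oppr_inj; rewrite oppr0 -compNl -p2d -compA -zE.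
    by rewrite compA pi21 comp0l.
  by rewrite -[x]comp1m -pi1 -compA zE z0 !comp0r.
have [J JE] := hom_post T j1; have [Q QE] := hom_post T q.
have JQ : short_exact J Q.
  split=> [x y|x|z].
  - rewrite !JE => xy; apply: subr0_eq; apply: j1_inj.
    by rewrite compBr; apply/eqP; rewrite subr_eq0; apply/eqP.
  - have [z ->] := dist_lift (dist_rotate abc)
      (gen_rigid (gen_by_refl T) Z1gen (c \oc x)).
    by exists (j2 \oc z); rewrite QE compA qj2.
  split=> [|[x <-]]; last by rewrite QE JE compA qj1 comp0l.
  rewrite QE => qz0.
  have [y yE] := dist_lift (dist_rotate dew)
    (gen_rigid (gen_by_refl T) Z1gen (w \oc z)).
  (* The [Z0]-component of [y] is [a \oc x], so [j2 \oc a = j1 \oc g] moves it into [X] as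
     [g \oc x]. *)
  have [x xE] : exists x : hom T Z1, p2 \oc y = a \oc x.
    by apply: (dist_lift abc); rewrite compA qE -compA -yE.
  exists (p1 \oc y + g \oc x); rewrite JE compDr [j1 \oc (g \oc x)]compA j12.
  rewrite -[j2 \oc a \oc x]compA -xE -!compA -compDr !compA -compDl ip.
  by rewrite comp1m yE.
have [s sE] := X_ext JQ.
have [bF bE] := hom_post T b; have [sb sbE] := rhom_comp s bF.
have [h hE] := yoneda sb Z0gen.
have ha0 : h \oc a = 0.
  apply: (gen_eq0l Z1gen) => u.
  by rewrite -compA -hE sbE bE compA (dist_comp0 abc) comp0l linear0.
(* After [q], both [j2] and [h] agree with [b] on maps from [T], so their difference comes from [X];
   composing with [a] leaves [j1 \oc g], as [h \oc a = 0]. *)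
have [r rE] : exists r : hom Z0 X, j2 - h = j1 \oc r.
  apply: (gen_lift Z0gen) => u.
  have [_ _ exJQ] := JQ.
  have [|r rE] := (exJQ ((j2 - h) \oc u)).1.
    rewrite QE compA compBr compBl qj2 -[q \oc h \oc u]compA -hE sbE bE -QE sE.
    exact: subrr.
  by exists r; rewrite -rE JE.
exists r; apply: subr0_eq; apply: (gen_eq0l Z1gen) => u; apply: j1_inj.
by rewrite compA compBr compA -rE j12 [(j2 - h) \oc a]compBl ha0 subr0 subrr comp0l.
Qed.

Lemma presented_rigid (Sigma : serre_functor C) :
  calabi_yau2 Sigma -> forall f : hom X (S X), f = 0.
Proof.
move=> CY.
have res_inj (f : hom X (S X)) : f \oc b = 0 -> f = 0.
  move=> fb0.
  (* [f'] is the suspension of some [g = r \oc a], and [fmap S a \oc c = 0]. *)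
  have [f' ->] := dist_extend (dist_rotate abc) fb0.
  have [g Sg] := susp_full f'.
  have [r rE] := extend_along_presentation g.
  rewrite -Sg rE fmap_comp -compA.
  have := dist_comp0 (dist_rotate (dist_rotate abc)).
  by rewrite compNl => /eqP; rewrite oppr_eq0 => /eqP ->; rewrite comp0r.
move=> f; have [h ->] := cy_surjective CY res_inj f.
by apply: res_inj; rewrite -compA (gen_rigid Z0gen Z0gen (h \oc b)) comp0r.
Qed.

(** * Generation by [X] of the cone of [T -> B] *)

Section TiltingSequence.
Context (B W : C) (t : hom T B) (beta : hom B W) (dl : hom W (S T)).
Hypotheses (tbd : dist t beta dl) (Bgen : gen_by X B).
Hypothesis t_inj : forall z : hom T T, t \oc z = 0 -> z = 0.

Lemma gen_of_rgen : rgen_by (F X) (F W) -> gen_by X W.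
Proof.
move=> [I [u [v uv1]]].
have [g gE] := fin_all_exists (fun i => hom_rmodule_full (u i)).
have [h hE] := fin_all_exists (fun i => hom_rmodule_full (v i)).
(* The lifted resolution of the identity sums to [idm W] only up to a map killed by [F]. *)
pose m := \sum_i (g i \oc h i).
have [|T1 [p [q [T1gen mE]]]] := @hom_rmodule_kernel W W (idm W - m).
  move=> z; rewrite compBl comp1m comp_suml -[X in X - _](uv1 z).
  apply/eqP; rewrite subr_eq0; apply/eqP; apply: eq_bigr => i _.
  by rewrite gE hE compA.
(* A map [S T -> W] has no component along [dl], hence factors through [B];
   a map [S T -> X] likewise factors through [Z0], which admits no nonzero
   map to [S T].  Hence [idm W - m] has square zero. *)
have [q' q'E] : exists q' : hom (S T1) B, q = beta \oc q'.
  apply: (dist_lift (dist_rotate tbd)).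
  apply: (gen_eq0l (gen_fmap S T1gen)) => z.
  have [y yE] := susp_full (dl \oc (q \oc z)).
  rewrite -compA -yE (_ : y = 0) ?fmap0 //.
  apply: t_inj; apply: susp_faithful.
  rewrite fmap_comp yE compA; apply: oppr_inj; rewrite oppr0 -!compNl.
  by rewrite (dist_comp0 (dist_rotate (dist_rotate tbd))) comp0l.
have pq0 : p \oc q = 0.
  rewrite q'E compA.
  have [J [x [y xy1]]] := Bgen.
  rewrite -[q']comp1m -xy1 comp_suml comp_sumr big1 // => j _.
  have [r rE] : exists r : hom (S T1) Z0, y j \oc q' = b \oc r.
    apply: (dist_lift (dist_rotate abc)).
    have [w wE] := susp_full (c \oc (y j \oc q')).
    rewrite -wE (_ : w = 0) ?fmap0 //.
    apply: (gen_eq0l T1gen) => z; apply: a_inj.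
    apply: susp_faithful; rewrite compA fmap_comp fmap_comp wE.
    have := dist_comp0 (dist_rotate (dist_rotate abc)).
    rewrite compNl => /eqP; rewrite oppr_eq0 => /eqP ac0.
    by rewrite [_ \oc (c \oc _)]compA ac0 !comp0l.
  rewrite -[x j \oc y j \oc q']compA rE !compA.
  by rewrite (gen_rigid Z0gen T1gen (_ \oc b)) comp0l.
(* As [q \oc p] has square zero, [idm W + q \oc p] is the inverse of [m = idm W - q \oc p]; it is
   absorbed into the [h i]. *)
exists I, (fun i => g i), (fun i => h i \oc (idm W + q \oc p)).
transitivity (m \oc (idm W + q \oc p)).
  by rewrite comp_suml; apply: eq_bigr => i _; rewrite compA.
have -> : m = idm W - q \oc p by rewrite -mE subKr.
rewrite compBl comp1m compDr compm1 -compA [p \oc (q \oc p)]compA pq0.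
by rewrite comp0l comp0r addr0 addrK.
Qed.

End TiltingSequence.

End Rigidity.

(* The map [kap : Y -> K] kills every map [T -> Y], as these factor through [B];
   hence it factors through [Y -> S T1], whose components [Y -> S T] lift to [W],
   and [Hom(W, K) = 0]. *)
Lemma cluster_tilting_of_sequence (Sigma : serre_functor C) (X B W : C)
    (t : hom T B) (beta : hom B W) (dl : hom W (S T)) :
  calabi_yau2 Sigma -> (forall f : hom X (S X), f = 0) ->
  dist t beta dl -> gen_by X B -> gen_by X W -> cluster_tilting X.
Proof.
move=> CY X_rigid tbd Bgen Wgen; split=> // Y YX0.
have XY0 : forall f : hom X (S Y), f = 0 := cy_ext1_sym CY YX0.
have [P [f [Pgen f_approx]]] := right_approx X Y (@tri_additive _ C).
have [K [kap [d fkd]]] := dist_cone f.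
(* A map [X -> K] lifts to [Y] because [Hom(X, S P) = 0], then factors through the approximation
   [f], and [kap \oc f = 0]. *)
have XK0 (h : hom X K) : h = 0.
  have [h' ->] := dist_lift (dist_rotate fkd)
    (gen_hom0 (gen_by_refl X) (gen_fmap S Pgen) X_rigid (d \oc h)).
  by have [g ->] := f_approx h'; rewrite compA (dist_comp0 fkd) comp0l.
have genK0 Z : gen_by X Z -> forall h : hom Z K, h = 0.
  by move=> Zgen h; apply: (gen_eq0l Zgen) => u; apply: XK0.
have [T1 [T0 [a [b [c [abc T1gen T0gen]]]]]] := presT Y.
have kb0 : kap \oc b = 0.
  apply: (gen_eq0l T0gen) => u.
  (* Since [Hom(W, S Y) = 0], the map [b \oc u] extends along [t] to [B], up to the sign from
     rotation. *)
  have Sbu : fmap S (b \oc u) \oc dl = 0.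
    exact: (gen_hom0 Wgen (gen_by_refl _) XY0).
  have [y yE] := dist_extend (dist_rotate (dist_rotate tbd)) Sbu.
  have [y' Sy'] := susp_full y.
  have -> : kap \oc b \oc u = - (kap \oc y' \oc t).
    rewrite -!compA -compNr; congr (_ \oc _); apply: subr0_eq.
    apply: susp_faithful; rewrite opprK fmapD yE fmap_comp Sy' compNr.
    exact: addNr.
  by rewrite (genK0 B Bgen (kap \oc y')) comp0l oppr0.
have [rho rhoE] := dist_extend (dist_rotate abc) kb0.
have kap0 : kap = 0.
  have [J [u [v uv1]]] := T1gen.
  rewrite rhoE -[c]comp1m -fmap1 -uv1 fmap_sum comp_suml comp_sumr big1 // => j _.
  have [w wE] : exists w : hom Y W, fmap S (v j) \oc c = dl \oc w.
    apply: (dist_lift (dist_rotate (dist_rotate tbd))).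
    exact: (gen_hom0 (gen_by_refl Y) (gen_fmap S Bgen) YX0).
  rewrite fmap_comp -[_ \oc _ \oc c]compA wE !compA.
  by rewrite (genK0 W Wgen (_ \oc dl)) comp0l.
have [s sE] : exists s : hom Y P, idm Y = f \oc s.
  by apply: (dist_lift fkd); rewrite kap0 comp0l.
apply: gen_in_add => //; first exact: tri_additive.
exact: (gen_retract (esym sE) Pgen).
Qed.

End ClusterTilting.

(** * Lifting a tilting module to the category *)

Theorem theorem3p3 (k : closedFieldType) (C : tricat k)
    (hKS : krull_schmidt C) (hsplit : split_idempotents C)
    (Sigma : serre_functor C) (hCY : calabi_yau2 Sigma)
    (T : C) (hT : cluster_tilting T)
    (L : rmodule (end_algebra T)) (hL : tilting_module L) :
  exists Lplus : C, cluster_tilting Lplus /\ rmod_iso (hom_rmodule T Lplus) L.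
Proof.
have [[P1 [P0 [i1 [p0 [projP1 projP0 [i1_inj p0_surj ex0]]]]]] extL] := hL.
move=> [L0 [L1 [i [p [[n [L0' isoL0]] [m [L1' isoL1]] [i_inj p_surj ex1]]]]]].
have addC := @tri_additive _ C; have [T_rigid _] := hT.
have presT Y := presentation Y hCY hT.
have T_exact (Z : C) (TZ : gen_by T Z) : forall f : hom T (susp C Z), f = 0.
  exact: (gen_rigid T_rigid (gen_by_refl T) TZ).
have [Z1 [Z1gen [phi1 /rhom_inverse [psi1 [phi1K psi1K]]]]] :=
  projective_lift addC hsplit projP1.
have [Z0 [Z0gen [phi0 /rhom_inverse [psi0 [phi0K psi0K]]]]] :=
  projective_lift addC hsplit projP0.
have [i1phi i1phiE] := rhom_comp i1 phi1.
have [aF aFE] := rhom_comp psi0 i1phi.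
have [a aE'] := yoneda aF Z1gen.
have aE (z : hom T Z1) : a \oc z = psi0 (i1 (phi1 z)) by rewrite -aE' aFE i1phiE.
have a_inj (w : hom T Z1) : a \oc w = 0 -> w = 0.
  rewrite aE => aw0; apply: (can_inj phi1K); apply: i1_inj; apply: (can_inj psi0K).
  by rewrite aw0 !linear0.
have [X [b [c abc]]] := dist_cone a.
have [bF bE] := hom_post T b; have [pL pLE] := rhom_comp p0 phi0.
have b_surj : rsurj bF.
  move=> x; have [z xE] := dist_lift (dist_rotate abc) (T_exact Z1 Z1gen (c \oc x)).
  by exists z; rewrite bE -xE.
have pL_surj : rsurj pL.
  by move=> x; have [y yE] := p0_surj x; exists (psi0 y); rewrite pLE psi0K.
(* Two surjections from [F Z0] with the same kernel have isomorphic targets, here [F X] and [L]. *)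
have ker_eq z : bF z = 0 <-> pL z = 0.
  rewrite bE pLE; split=> [/(dist_lift abc) [w ->]|/ex0 [y yE]].
    by rewrite aE psi0K; apply/ex0; exists (phi1 w).
  have -> : z = a \oc (psi1 y : hom T Z1) by rewrite aE psi1K yE phi0K.
  by rewrite compA (dist_comp0 abc) comp0l.
have [h hE] := rhom_factor b_surj (fun z => (ker_eq z).1).
have [h' h'E] := rhom_factor pL_surj (fun z => (ker_eq z).2).
have hK : cancel h h' by move=> x; have [z <-] := b_surj x; rewrite hE h'E.
have h'K : cancel h' h by move=> x; have [z <-] := pL_surj x; rewrite h'E hE.
have X_ext := rmod_ext1_zero_iso hK h'K extL.
exists X; split; last by exists h; exists h'.
have X_rigid := presented_rigid T_rigid abc Z1gen Z0gen a_inj X_ext hCY.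
have [B sumB] := addC n (fun=> X); have Bgen := gen_power sumB.
have [Phi [Psi [PhiK PsiK]]] := hom_rmodule_pow sumB hK h'K.
have [gL0 gL0'] := in_add_rgen isoL0; have [gL1 _] := in_add_rgen isoL1.
have [Th /rhom_inverse [Th' [ThK Th'K]]] := isoL0.
have [in1 [in2 [pr1 [pr2 [in1K in2K pr21 pr12 in_pr]]]]] := sum_projections L0 L0'.
(* Identifying [F B] with [L^n] and then with the sum of [L0] and [L0'] makes [s1], [s2] the
   inclusions and [q1], [q2] the projections of these summands. *)
have [Ths1 Ths1E] := rhom_comp Th in1; have [s1 s1E'] := rhom_comp Psi Ths1.
have [Ths2 Ths2E] := rhom_comp Th in2; have [s2 s2E'] := rhom_comp Psi Ths2.
have [ThPhi ThPhiE] := rhom_comp Th' Phi.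
have [q1 q1E'] := rhom_comp pr1 ThPhi; have [q2 q2E'] := rhom_comp pr2 ThPhi.
have s1E x : s1 x = Psi (Th (in1 x)) by rewrite s1E' Ths1E.
have s2E x : s2 x = Psi (Th (in2 x)) by rewrite s2E' Ths2E.
have q1E y : q1 y = pr1 (Th' (Phi y)) by rewrite q1E' ThPhiE.
have q2E y : q2 y = pr2 (Th' (Phi y)) by rewrite q2E' ThPhiE.
have s1K : cancel s1 q1 by move=> x; rewrite q1E s1E PsiK ThK in1K.
have qs21 x : q2 (s1 x) = 0 by rewrite q2E s1E PsiK ThK pr21.
have sq y : s1 (q1 y) + s2 (q2 y) = y.
  by rewrite s1E s2E q1E q2E -(linearD Psi) -(linearD Th) /= in_pr Th'K PhiK.
(* By Yoneda, [s1] after [i] is composition with its value at the identity. *)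
pose t : hom T B := s1 (i (idm T)).
have tE (z : hom T T) : t \oc z = s1 (i z).
  by rewrite -[in RHS](comp1m z) (rhomM i (idm T) z) (rhomM s1).
have t_inj (z : hom T T) : t \oc z = 0 -> z = 0.
  by rewrite tE => s1z0; apply: i_inj; apply: (can_inj s1K); rewrite s1z0 !linear0.
have [W [beta [dl tbd]]] := dist_cone t.
have [bet betE] := hom_post T beta.
have bet_surj : rsurj bet.
  move=> x; have [z xE] := dist_lift (dist_rotate tbd)
    (T_exact T (gen_by_refl T) (dl \oc x)).
  by exists z; rewrite betE -xE.
have beta_ker y : bet y = 0 -> exists z, y = s1 (i z).
  by rewrite betE => /(dist_lift tbd) [z ->]; exists z; rewrite tE.
(* The image of [F t] lies in the summand [L0], where its cokernel is [L1]; so [F W] is the sum of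
   [L1] and [L0'], through the induced maps [e1], [e2], [d1], [d2]. *)
have [pq pqE] := rhom_comp p q1.
have [e1 e1E] : exists e1 : rhom (hom_rmodule T W) L1, forall y, e1 (bet y) = pq y.
  apply: (rhom_factor bet_surj) => y /beta_ker [z ->].
  by rewrite pqE s1K; apply/ex1; exists z.
have [e2 e2E] : exists e2 : rhom (hom_rmodule T W) L0', forall y, e2 (bet y) = q2 y.
  by apply: (rhom_factor bet_surj) => y /beta_ker [z ->].
have [bs bsE] := rhom_comp bet s1.
have [d1 d1E] : exists d1 : rhom L1 (hom_rmodule T W), forall x, d1 (p x) = bs x.
  apply: (rhom_factor p_surj) => x /ex1 [z <-].
  by rewrite bsE -tE betE compA (dist_comp0 tbd) comp0l.
have [d2 d2E] := rhom_comp bet s2.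
have de y : d1 (e1 y) + d2 (e2 y) = y.
  have [x <-] := bet_surj y.
  by rewrite e1E e2E pqE d1E bsE d2E -(linearD bet) /= sq.
have Wgen : gen_by X W.
  apply: (gen_of_rgen T_rigid presT abc Z0gen a_inj tbd Bgen t_inj).
  exact: (rgen_iso h'K (rgen_split de gL1 gL0')).
exact: (cluster_tilting_of_sequence hsplit presT hCY X_rigid tbd Bgen Wgen).
Qed.
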